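(* Let $r,s\geq 3$ be odd integers. Define $f(z)=z^r$, $g(z)=z^s$, and $c(z)=-z$. Then the modified rank-two recurrence set $$\tilde{S}_{f,g,c}^2:=\left\{(m,n)\in\mathbb{Z}_{\geq 0}^2 : \exists\lambda\in\mathbb{C}^\times,\ f^{\circ m}(\lambda)=g^{\circ n}(\lambda)=c(\lambda)\right\}$$ is not a semi-linear subset of $\mathbb{Z}_{\geq 0}^2$.
   Context: For a polynomial $h$ and $n\geq 1$, $h^{\circ n}$ is the $n$-th iterate of $h$ and $h^{\circ 0}(z)=z$. A subset of $\mathbb{Z}_{\geq 0}^k$ is called linear if it is of the form $a+M$, where $a\in\mathbb{Z}_{\geq 0}^k$ and $M$ is the submonoid of $(\mathbb{Z}_{\geq 0}^k,+,0)$ generated by a finite subset $P\subseteq\mathbb{Z}_{\geq 0}^k$. A subset of $\mathbb{Z}_{\geq 0}^k$ is called semi-linear if it is a finite (possibly empty) union of linear subsets. *)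

(* Defs.v *)
From HB Require Import structures.
From mathcomp Require Import all_boot all_order all_algebra.
From mathcomp Require Import complex.
From mathcomp Require Import boolp classical_sets functions cardinality reals.

Set Implicit Arguments.
Unset Strict Implicit.
Unset Printing Implicit Defensive.

Import Order.TTheory GRing.Theory Num.Theory.

Local Open Scope classical_set_scope.
Local Open Scope ring_scope.

Definition submonoid (V : nmodType) (M : set V) : Prop :=
  M 0 /\ forall x y, M x -> M y -> M (x + y).

Definition generated_submonoid (V : nmodType) (P : set V) : set V :=
  smallest (@submonoid V) P.

Definition linear_set (k : nat) (L : set 'rV[nat]_k) : Prop :=
  exists (a : 'rV[nat]_k) (P : set 'rV[nat]_k),
    finite_set P /\ L = [set a + x | x in generated_submonoid P].

Definition semilinear_set (k : nat) (A : set 'rV[nat]_k) : Prop :=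
  exists F : set (set 'rV[nat]_k),
    [/\ finite_set F, forall L, F L -> linear_set L & A = \bigcup_(L in F) L].

(* h \Po p is the composite h(p(z)), so this is the n-fold composite of h. *)
Definition poly_iter (K : nzRingType) (h : {poly K}) (n : nat) : {poly K} :=
  iter n (fun p => h \Po p) 'X.

(* A pair (m, n) is the row vector v with m = v 0 0 and n = v 0 1. *)
Definition modified_recurrence_set (R : realType) (f g c : {poly R[i]}) :
    set 'rV[nat]_2 :=
  [set v | exists l : R[i],
    [/\ l != 0,
        (poly_iter f (v 0 0)).[l] = (poly_iter g (v 0 1)).[l] &
        (poly_iter g (v 0 1)).[l] = c.[l]]].

(* Main.v *)
(** A scalar [l] with [l ^ a = l ^ b = -1] and [a, b > 0] exists iff [a] and [b]
    have the same 2-adic valuation, so the set consists of the [(m, n)] with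
    [m, n > 0] and [v2 (r ^ m - 1) = v2 (s ^ n - 1)].  Lifting the exponent gives
    points of this set with pairwise distinct slopes and arbitrarily 2-divisible
    coordinates.  If finitely many linear sets covered it, one of them would have
    base point [a] and contain such a point [a + x] not parallel to [a], hence
    also the ray [a + t x].  Some [t] makes the first coordinate of [a + t x]
    divisible by a huge power of 2; the valuation condition then forces the
    second one to be so too, and this power divides the nonzero determinant of
    [a] and [x]. *)
Require Import Defs.
From mathcomp Require Import all_boot all_order all_algebra.
From mathcomp Require Import complex.
From mathcomp Require Import boolp classical_sets functions cardinality reals.
From mathcomp Require Import zify.

Set Implicit Arguments.
Unset Strict Implicit.
Unset Printing Implicit Defensive.

Import Order.TTheory GRing.Theory Num.Theory.

Local Open Scope ring_scope.

(** * Membership in terms of 2-adic valuations *)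

Lemma horner_poly_iter_Xn (K : comNzRingType) (r m : nat) (l : K) :
  (poly_iter 'X^r m).[l] = l ^+ (r ^ m).
Proof.
elim: m => [|m IHm]; first by rewrite /poly_iter /= hornerX expr1.
have -> : poly_iter ('X^r : {poly K}) m.+1 = 'X^r \Po poly_iter 'X^r m by [].
by rewrite horner_comp hornerXn IHm -exprM expnSr.
Qed.

Lemma logn2_odd_mul (k q : nat) : odd q -> logn 2 (2 ^ k * q)%N = k.
Proof.
move=> oq; rewrite lognM ?expn_gt0 ?(odd_gt0 oq) // pfactorK // lognE.
by rewrite dvdn2 oq andbF addn0.
Qed.

Lemma logn2_split (n : nat) : (0 < n)%N ->
  exists2 q, odd q & n = (2 ^ logn 2 n * q)%N.
Proof.
move=> n_gt0; have [q cq ->] := pfactor_coprime (isT : prime 2) n_gt0.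
by exists q; rewrite -?coprime2n // mulnC logn2_odd_mul // -coprime2n.
Qed.

(** Any root of -1 of order the common power of 2 works: the cofactors of [a] and [b] are odd. *)
Lemma logn2_eq_common_root (C : numClosedFieldType) (a b : nat) :
    (0 < a)%N -> (0 < b)%N -> logn 2 a = logn 2 b ->
  exists l : C, [/\ l != 0, l ^+ a = -1 & l ^+ b = -1].
Proof.
move=> a_gt0 b_gt0 eab.
have [p op Da] := logn2_split a_gt0; have [q oq Db] := logn2_split b_gt0.
have N_gt0 : (0 < 2 ^ logn 2 a)%N by rewrite expn_gt0.
pose l : C := (2 ^ logn 2 a).-root (-1).
have lN : l ^+ (2 ^ logn 2 a) = -1 by rewrite /l rootCK.
exists l; split.
- apply/eqP => l0; move/eqP: lN; rewrite l0 expr0n gtn_eqF //= eq_sym.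
  by rewrite oppr_eq0 oner_eq0.
- by rewrite Da exprM lN -signr_odd op expr1.
- by rewrite Db -eab exprM lN -signr_odd oq expr1.
Qed.

(** If [b] had the smaller valuation, [a * q] would be an even multiple of [b], with [q] the odd
    part of [b]; then [l ^+ (a * q)] would be both -1 and 1. *)
Lemma common_root_logn2_le (K : numDomainType) (l : K) (a b : nat) :
    (0 < a)%N -> (0 < b)%N -> l ^+ a = -1 -> l ^+ b = -1 ->
  (logn 2 a <= logn 2 b)%N.
Proof.
move=> a_gt0 b_gt0 la lb; rewrite leqNgt; apply/negP => lt_ba.
have [p op Da] := logn2_split a_gt0; have [q oq Db] := logn2_split b_gt0.
have [e De] : exists e, logn 2 a = (logn 2 b + e.+1)%N.
  by exists (logn 2 a - (logn 2 b).+1)%N; rewrite addnS -addSn subnKC.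
have E : (a * q = b * (2 ^ e.+1 * p))%N.
  rewrite {1}Da De {2}Db expnD -!mulnA; congr (_ * _)%N.
  by rewrite [(p * q)%N]mulnC mulnCA.
have : l ^+ (a * q) = l ^+ (b * (2 ^ e.+1 * p)) by rewrite E.
rewrite !exprM la lb -signr_odd oq expr1 -[(-1) ^+ _]signr_odd oddX /= expr0.
rewrite expr1n => /eqP.
by rewrite eq_sym -subr_eq0 opprK -mulr2n pnatr_eq0.
Qed.

(** Dividing [l ^+ (r ^ m) = - l] by [l] gives [l ^+ (r ^ m - 1) = -1], and likewise for [s] and
    [n]. A zero iterate is excluded because [l = - l] forces [l = 0]. *)
Lemma modified_recurrence_setE (R : realType) (r s : nat) (v : 'rV[nat]_2)
    (m n : nat) :
    (1 < r)%N -> (1 < s)%N -> v 0 0 = m -> v 0 1 = n ->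
  modified_recurrence_set ('X^r : {poly R[i]}) 'X^s (- 'X) v <->
  [/\ (0 < m)%N, (0 < n)%N &
      logn 2 (r ^ m - 1)%N = logn 2 (s ^ n - 1)%N].
Proof.
move=> r_gt1 s_gt1 vm vn.
have pow_sub (l : R[i]) (e : nat) : (0 < e)%N -> l != 0 ->
    (l ^+ e = - l) <-> (l ^+ (e - 1) = -1).
  move=> e_gt0 l0; rewrite -{1}(subnK e_gt0) exprD expr1 -[- l]mulN1r.
  by split=> [/(mulIf l0)|->].
have pow_pos (t k : nat) (l : R[i]) : (1 < t)%N -> l != 0 ->
    l ^+ (t ^ k) = - l -> (0 < k)%N.
  case: k => // t_gt1 l0 /eqP.
  by rewrite expr1 -subr_eq0 opprK -mulr2n mulrn_eq0 (negPf l0).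
have sub_gt0 (t k : nat) : (1 < t)%N -> (0 < k)%N -> (0 < t ^ k - 1)%N.
  by move=> t1 n0; rewrite subn_gt0 -{1}(expn0 t) ltn_exp2l.
have exp_gt0 (t k : nat) : (1 < t)%N -> (0 < t ^ k)%N.
  by move=> t1; rewrite expn_gt0 (ltnW t1).
rewrite /modified_recurrence_set /= vm vn; split.
- move=> [l]; rewrite !horner_poly_iter_Xn hornerN hornerX => -[l0 E1 E2].
  rewrite E2 in E1.
  have m0 := pow_pos _ _ _ r_gt1 l0 E1; have n0 := pow_pos _ _ _ s_gt1 l0 E2.
  move/pow_sub: E1 => /(_ (exp_gt0 _ _ r_gt1) l0) E1.
  move/pow_sub: E2 => /(_ (exp_gt0 _ _ s_gt1) l0) E2.
  split=> //; apply/eqP; rewrite eqn_leq.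
  by rewrite !(@common_root_logn2_le _ l) ?sub_gt0.
- move=> [m0 n0 E].
  have [l [l0 E1 E2]] := @logn2_eq_common_root R[i] _ _
    (sub_gt0 _ _ r_gt1 m0) (sub_gt0 _ _ s_gt1 n0) E.
  have {}E1 := (pow_sub _ _ (exp_gt0 _ m r_gt1) l0).2 E1.
  have {}E2 := (pow_sub _ _ (exp_gt0 _ n s_gt1) l0).2 E2.
  exists l; rewrite !horner_poly_iter_Xn hornerN hornerX.
  by split; rewrite // E1 E2.
Qed.

(** * Lifting the exponent at the prime 2 *)

Lemma logn2_expn_odd_sub1 (x q : nat) : (1 < x)%N -> odd x -> odd q ->
  logn 2 (x ^ q - 1)%N = logn 2 (x - 1)%N.
Proof.
move=> x_gt1 ox oq.
have -> : (x ^ q - 1 = (x - 1) * \sum_(i < q) x ^ i)%N.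
  by rewrite !subn1 predn_exp.
(* A sum of [q] odd terms has the parity of [q]. *)
have os : odd (\sum_(i < q) x ^ i)%N.
  suff -> : odd (\sum_(i < q) x ^ i)%N = odd q by [].
  elim: (q) => [|k IHk]; first by rewrite big_ord0.
  by rewrite big_ord_recr /= oddD /= IHk oddX ox orbT addbT.
rewrite lognM ?subn_gt0 ?(odd_gt0 os) //.
by rewrite [X in (_ + X)%N]lognE dvdn2 os andbF addn0.
Qed.

(** For odd [x], [x ^ 2 + 1] is 2 modulo 4, so it contributes exactly one factor 2. *)
Lemma logn2_sqr_sub1 (x : nat) : (1 < x)%N -> odd x ->
  logn 2 ((x ^ 2) ^ 2 - 1)%N = (logn 2 (x ^ 2 - 1)%N).+1.
Proof.
move=> x_gt1 ox.
have -> : ((x ^ 2) ^ 2 - 1 = (x ^ 2 - 1) * (x ^ 2 + 1))%N.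
  by rewrite -subn_sqr exp1n.
have [h Dx] : exists h, x = (h.*2.+1)%N.
  by exists x./2; rewrite -{1}(odd_double_half x) ox.
have -> : (x ^ 2 + 1 = 2 ^ 1 * (h ^ 2 + h).*2.+1)%N.
  by rewrite Dx; lia.
rewrite lognM ?logn2_odd_mul ?addn1 /= ?odd_double //.
by rewrite subn_gt0 -{1}(exp1n 2) ltn_exp2r.
Qed.

(** The odd part of [n] does not matter, and each squaring after the first adds one. The first may
    add more, since 4 can divide [x + 1]; hence the base value at [x ^ 2]. *)
Lemma logn2_expn_even_sub1 (x n : nat) : (1 < x)%N -> odd x -> (0 < n)%N ->
  logn 2 (x ^ n.*2 - 1)%N = (logn 2 (x ^ 2 - 1)%N + logn 2 n)%N.
Proof.
move=> x_gt1 ox n_gt0; have [q oq Dn] := logn2_split n_gt0.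
have pow_gt1 y k : (1 < y)%N -> (1 < y ^ 2 ^ k)%N.
  by move=> y_gt1; rewrite -{1}(expn0 y) ltn_exp2l ?expn_gt0.
have pow_odd y k : odd y -> odd (y ^ k)%N by move=> oy; rewrite oddX oy orbT.
rewrite {1}Dn -mul2n expnM expnM logn2_expn_odd_sub1 ?pow_odd //; last first.
  by rewrite pow_gt1 // (pow_gt1 x 1).
elim: (logn 2 n) => [|k IHk]; first by rewrite expn0 expn1 addn0.
have E : ((x ^ 2) ^ 2 ^ k = (x ^ 2 ^ k) ^ 2)%N by rewrite -!expnM mulnC.
rewrite addnS -IHk [(2 ^ k.+1)%N]expnSr [((x ^ 2) ^ (_ * 2))%N]expnM E.
by rewrite logn2_sqr_sub1 ?pow_odd ?pow_gt1.
Qed.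

Lemma logn2_expn_sub1_le (x n : nat) : (1 < x)%N -> odd x -> (0 < n)%N ->
  (logn 2 (x ^ n - 1)%N <= logn 2 (x ^ 2 - 1)%N + logn 2 n)%N.
Proof.
move=> x_gt1 ox n_gt0; have [on|en] := boolP (odd n).
  have x2_gt0 : (0 < x ^ 2 - 1)%N by rewrite subn_gt0 -{1}(exp1n 2) ltn_exp2r.
  rewrite logn2_expn_odd_sub1 // (leq_trans _ (leq_addr _ _)) //.
  by rewrite dvdn_leq_log // -[X in (_ ^ 2 - X)%N](exp1n 2) subn_sqr dvdn_mulr.
move: n_gt0; rewrite -(even_halfK en) double_gt0 => h_gt0.
rewrite logn2_expn_even_sub1 // leq_add2l dvdn_leq_log ?double_gt0 //.
by rewrite -muln2 dvdn_mulr.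
Qed.

(** * Rays in linear sets and finite covers *)

Lemma rV_mulrnE (k t : nat) (x : 'rV[nat]_k) (i : 'I_1) (j : 'I_k) :
  (x *+ t) i j = (t * x i j)%N.
Proof. by elim: t => [|t IHt]; rewrite ?mulr0n ?mulrS !mxE // IHt mulSn. Qed.

Lemma submonoid_mulrn (V : nmodType) (M : set V) (x : V) (t : nat) :
  submonoid M -> M x -> M (x *+ t).
Proof.
by move=> [M0 MD] Mx; elim: t => [|t IHt]; rewrite ?mulr0n ?mulrS //; apply: MD.
Qed.

Lemma generated_submonoidP (V : nmodType) (P : set V) :
  submonoid (generated_submonoid P).
Proof.
split=> [M [[M0 _] _] //|x y Mx My M subM].
by have [[_ MD] _] := subM; apply: MD; [apply: Mx|apply: My].
Qed.

Lemma linear_set_ray (k : nat) (L : set 'rV[nat]_k) : linear_set L ->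
  exists2 a, L a & forall p, L p ->
    exists x, p = a + x /\ forall t, L (a + x *+ t).
Proof.
move=> [a [P [_ ->]]]; exists a.
  by exists 0; [exact: (generated_submonoidP P).1 | rewrite addr0].
move=> _ [x Mx <-]; exists x; split=> // t.
by exists (x *+ t) => //; exact: submonoid_mulrn (generated_submonoidP P) Mx.
Qed.

(** Pigeonhole: otherwise each member of [F] would contain [p j] for boundedly many [j] only, making
    [nat] a finite union of finite sets. *)
Lemma finite_cover_cofinal (T : Type) (F : set (set T)) (p : nat -> T) :
    finite_set F -> (forall j, exists2 L, F L & L (p j)) ->
  exists2 L, F L & forall N, exists2 j, (N <= j)%N & L (p j).
Proof.
move=> finF covF; apply: contrapT => nL; apply: infinite_nat.
apply: (@sub_finite_set _ _ (\bigcup_(L in F) [set j | L (p j)])%classic).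
  by move=> j _; have [L FL Lj] := covF j; exists L.
apply: bigcup_finite => // L FL; apply: contrapT => infL; apply: nL.
exists L => // N; apply: contrapT => nj; apply: infL.
apply: (sub_finite_set _ (finite_II N)) => j Lj /=.
by rewrite ltnNge; apply/negP => le_Nj; apply: nj; exists j.
Qed.

(** * Divisibility along a ray *)

Lemma logn_dvdn_addr (p a x : nat) : prime p -> (0 < a)%N -> (0 < x)%N ->
  (p ^ (logn p a).+1 %| a + x)%N -> logn p a = logn p x.
Proof.
move=> pr_p a_gt0 x_gt0 dvd; apply/eqP; rewrite eqn_leq; apply/andP; split.
  rewrite -pfactor_dvdn // -(@dvdn_addr a) ?pfactor_dvdnn //.
  by apply: dvdn_trans dvd; rewrite dvdn_exp2l.
rewrite leqNgt -pfactor_dvdn //; apply/negP => dvdx.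
by move: dvd; rewrite dvdn_addl // pfactor_dvdn // ltnn.
Qed.

Lemma exists_dvdn_addmul (a x N : nat) : (0 < a)%N -> (0 < x)%N ->
  logn 2 a = logn 2 x -> exists t, (2 ^ N %| a + t * x)%N.
Proof.
move=> a_gt0 x_gt0 e; have [a' _ Da] := logn2_split a_gt0.
have [x' ox Dx] := logn2_split x_gt0.
have co : coprime (2 ^ N) x' by rewrite coprimeXl // coprime2n.
(* Cancelling the common power of 2 leaves [t * x' = - a'] modulo [2 ^ N]; [y] is to be [t * x'],
   and [2 ^ N - 1] plays the role of -1. *)
pose y := chinese (2 ^ N) x' (a' * (2 ^ N - 1)) 0.
have /dvdnP[t Dt] : (x' %| y)%N.
  by rewrite /dvdn /y chinese_modr // mod0n.
exists t; rewrite Da Dx -e mulnCA -Dt -mulnDr dvdn_mull // /dvdn -modnDmr.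
rewrite /y chinese_modl // modnDmr -[X in (X + _)%N]muln1 -mulnDr subnKC.
  by rewrite modnMl.
by rewrite expn_gt0.
Qed.

Lemma equal_logn2_ray_parallel (r s a1 a2 x1 x2 : nat) :
    (1 < r)%N -> (1 < s)%N -> odd r -> odd s ->
    (0 < a1)%N -> (0 < x1)%N -> logn 2 a1 = logn 2 x1 ->
    (forall t, (0 < a2 + t * x2)%N /\
      logn 2 (r ^ (a1 + t * x1) - 1)%N = logn 2 (s ^ (a2 + t * x2) - 1)%N) ->
  (x2 * a1 = x1 * a2)%N.
Proof.
move=> r1 s1 or os a1_gt0 x1_gt0 e ray; apply/eqP/negPn/negP => neq.
(* One of the two truncated differences vanishes, so [D] is the absolute value
   of the determinant of [a] and [x]. *)
pose D := ((x2 * a1 - x1 * a2) + (x1 * a2 - x2 * a1))%N.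
have D_gt0 : (0 < D)%N.
  by rewrite addn_gt0 !subn_gt0 orbC -neq_ltn.
(* The extra factor 2 makes the first coordinate even, so that the exact formula applies to its
   half. The summand [logn 2 (s ^ 2 - 1)] is then cancelled by the upper bound for [s], leaving
   [2 ^ D] as a divisor of the second coordinate. *)
have [t dvd1] :=
  exists_dvdn_addmul (logn 2 (s ^ 2 - 1)%N + D).+1 a1_gt0 x1_gt0 e.
have [n_gt0 E] := ray t.
have m_gt0 : (0 < a1 + t * x1)%N by rewrite addn_gt0 a1_gt0.
have le_m : (logn 2 (s ^ 2 - 1)%N + D <= logn 2 (r ^ (a1 + t * x1) - 1)%N)%N.
  have := dvd1; rewrite expnS mulnC => /dvdnP[h Dm].
  rewrite Dm mulnA muln2 in m_gt0 *.
  rewrite logn2_expn_even_sub1 // ?(leq_trans _ (leq_addl _ _)) //.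
    by rewrite -pfactor_dvdn ?dvdn_mull // -double_gt0.
  by rewrite -double_gt0.
have dvd2 : (2 ^ D %| a2 + t * x2)%N.
  rewrite pfactor_dvdn // -(leq_add2l (logn 2 (s ^ 2 - 1)%N)).
  by rewrite (leq_trans le_m) // E logn2_expn_sub1_le.
have {}dvd1 : (2 ^ D %| a1 + t * x1)%N.
  by apply: dvdn_trans dvd1; rewrite dvdn_exp2l // -addSn leq_addl.
(* The determinant is unchanged when [a] moves along the ray: both products gain [t * (x1 * x2)]. *)
have eq1 : (x2 * (a1 + t * x1) = x2 * a1 + t * (x1 * x2))%N by lia.
have eq2 : (x1 * (a2 + t * x2) = x1 * a2 + t * (x1 * x2))%N by lia.
set m := (a1 + _)%N in dvd1 eq1; set n := (a2 + _)%N in dvd2 eq2.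
have DE : D = ((x2 * m - x1 * n) + (x1 * n - x2 * m))%N.
  by rewrite eq1 eq2 !subnDr.
have : (2 ^ D %| D)%N.
  rewrite [X in (_ %| X)%N]DE.
  by apply: dvdn_add; apply: dvdn_sub; apply: dvdn_mull.
by move/(dvdn_leq D_gt0); rewrite leqNgt ltn_expl.
Qed.

Theorem proposition1p9 (R : realType) (r s : nat)
    (hr3 : (3 <= r)%N) (hs3 : (3 <= s)%N) (hr : odd r) (hs : odd s) :
  ~ semilinear_set
      (modified_recurrence_set ('X^r : {poly R[i]}) 'X^s (- 'X)).
Proof.
have r1 : (1 < r)%N by apply: leq_trans hr3.
have s1 : (1 < s)%N by apply: leq_trans hs3.
set S := modified_recurrence_set _ _ _ => -[F [finF linF DS]].
pose A := logn 2 (r ^ 2 - 1)%N; pose B := logn 2 (s ^ 2 - 1)%N.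
(* The exponents carry [B] resp. [A] crosswise so that both valuations equal
   [A + B + j]; the odd factor separates the slopes. *)
pose P1 j := (2 ^ (j + B).+1)%N; pose P2 j := (2 ^ (j + A).+1 * j.*2.+1)%N.
pose p (j : nat) : 'rV[nat]_2 := \row_i (if i == 0 then P1 j else P2 j).
have p0 j : p j 0 0 = P1 j by rewrite mxE.
have p1 j : p j 0 1 = P2 j by rewrite mxE.
have Sp j : S (p j).
  apply: (modified_recurrence_setE R r1 s1 (p0 j) (p1 j)).2.
  rewrite /P1 /P2 !expnS -mulnA !mul2n.
  rewrite !double_gt0 muln_gt0 !expn_gt0; split=> //.
  rewrite !logn2_expn_even_sub1 ?muln_gt0 ?expn_gt0 //.
  rewrite pfactorK // logn2_odd_mul /= ?odd_double //.
  by rewrite -/A -/B; lia.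
have [L FL cofL] : exists2 L, F L & forall N, exists2 j, (N <= j)%N & L (p j).
  by apply: finite_cover_cofinal => // j; move: (Sp j); rewrite DS => -[L]; exists L.
have LS v : L v -> S v by rewrite DS => Lv; exists L.
have [a La ray] := linear_set_ray (linF L FL).
have [a1 Da1] : exists a1, a 0 0 = a1 by eexists.
have [a2 Da2] : exists a2, a 0 1 = a2 by eexists.
have [a1_gt0 _ _] := (modified_recurrence_setE R r1 s1 Da1 Da2).1 (LS a La).
(* The bound [a1 <= j] makes [P1 j] exceed [a1] and be divisible by [2 ^ (logn 2 a1).+1], so [x1] is
   positive with the valuation of [a1]. *)
have par j : (a1 <= j)%N -> L (p j) -> (P2 j * a1 = P1 j * a2)%N.
  move=> le_aj /ray[x [Dp rayx]].
  have [x1 Dx1] : exists x1, x 0 0 = x1 by eexists.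
  have [x2 Dx2] : exists x2, x 0 1 = x2 by eexists.
  have DP1 : P1 j = (a1 + x1)%N by rewrite -p0 Dp mxE Da1 Dx1.
  have DP2 : P2 j = (a2 + x2)%N by rewrite -p1 Dp mxE Da2 Dx2.
  have lt_ap : (a1 < P1 j)%N.
    rewrite (leq_ltn_trans le_aj) // (leq_trans (ltn_expl _ (ltnSn 1))) //.
    by rewrite leq_exp2l // -addnS leq_addr.
  have x1_gt0 : (0 < x1)%N by move: lt_ap; rewrite DP1 -{1}[a1]addn0 ltn_add2l.
  have e : logn 2 a1 = logn 2 x1.
    apply: logn_dvdn_addr => //; rewrite -DP1 dvdn_exp2l // ltnS.
    rewrite (leq_trans (ltnW (ltn_logl _ a1_gt0))) //.
    by rewrite (leq_trans le_aj) ?leq_addr.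
  rewrite DP1 DP2 !mulnDl (@equal_logn2_ray_parallel r s a1 a2 x1 x2) //.
    by rewrite [(a2 * _)%N]mulnC.
  move=> t.
  have c1 : (a + x *+ t) 0 0 = (a1 + t * x1)%N by rewrite mxE rV_mulrnE Da1 Dx1.
  have c2 : (a + x *+ t) 0 1 = (a2 + t * x2)%N by rewrite mxE rV_mulrnE Da2 Dx2.
  by have [] := (modified_recurrence_setE R r1 s1 c1 c2).1 (LS _ (rayx t)).
(* After cancelling [2 ^ i.+1], only the left side depends on [i], so two distinct indices
   contradict [a1 > 0]. *)
have slope i : (a1 <= i)%N -> L (p i) ->
    (2 ^ A * a1 * i.*2.+1 = 2 ^ B * a2)%N.
  move=> le_ai Li; apply/eqP; rewrite -(@eqn_pmul2l (2 ^ i.+1)) ?expn_gt0 //.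
  have := par i le_ai Li; rewrite /P1 /P2 -!addSn !expnD => E.
  by apply/eqP; lia.
have [j le_aj Lj] := cofL a1; have [k lt_jk Lk] := cofL j.+1.
have /eqP := slope k (leq_trans le_aj (ltnW lt_jk)) Lk.
rewrite -(slope j le_aj Lj) eqn_pmul2l ?muln_gt0 ?expn_gt0 //.
by rewrite eqSS -!mul2n eqn_pmul2l // gtn_eqF.
Qed.
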